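(* For every integer $n\geq 1$, $$T(3,n) = G_n(3,1) + 2\,G_{n-1}(3,0).$$
   Context: The Super-Catalan numbers are $T(m,n) := \frac{1}{2}\cdot\frac{(2m)!\,(2n)!}{m!\,n!\,(m+n)!}$ for integers $m\ge 0$, $n\geq 1$. A Dyck path of length $2\ell$ ($\ell\ge 0$) is a sequence $\pi=(\pi(1),\dots,\pi(2\ell))$ with each $\pi(k)=\pm1$, $\sum_{i=1}^{2\ell}\pi(i)=0$, and $\sum_{i=1}^k\pi(i)\ge 0$ for all $1\le k\le 2\ell$; its length is $|\pi|=2\ell$. Its height is $h(\pi)=\max_k\sum_{i=1}^k\pi(i)$, and the unique Dyck path $\epsilon$ of length $0$ has $h(\epsilon)=0$. For integers $m\ge 1$, $k\ge 0$ and $n$, $G_n(m,k)$ is the number of $m$-tuples $(\pi^{(1)},\dots,\pi^{(m)})$ of Dyck paths with $\sum_{i=1}^m|\pi^{(i)}|=2n$ and $|h(\pi^{(i)})-h(\pi^{(j)})|\le k$ for all $i,j$ (so $G_n(m,k)=0$ for $n<0$). *)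

(* Defs.v *)
From mathcomp Require Import all_boot all_order all_algebra.
Set Implicit Arguments.
Unset Strict Implicit.
Unset Printing Implicit Defensive.
Import Order.TTheory GRing.Theory Num.Theory.
Local Open Scope ring_scope.

Definition superCatalan (m n : nat) : rat :=
  1 / 2 * (((2 * m)`! * (2 * n)`!)%N%:R / (m`! * n`! * (m + n)`!)%N%:R).

(* Lattice paths are encoded as bit sequences, so that paths of bounded length
   form a finite type: [true] is the step +1 and [false] the step -1. *)
Definition step (b : bool) : int := if b then 1 else -1.

Definition psum (p : seq bool) (k : nat) : int := \sum_(b <- take k p) step b.

(* The length of a path with zero total sum is automatically even. *)
Definition dyck (p : seq bool) : bool :=
  (psum p (size p) == 0) && all (fun k => 0 <= psum p k) (iota 1 (size p)).

(* Only used on Dyck paths, whose partial sums are nonnegative; the default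
   value 0 then only matters for the empty path. *)
Definition height (p : seq bool) : int :=
  \big[Num.max/0]_(1 <= k < (size p).+1) psum p k.

(* The bound absz (2 * n) on the length of each path makes the type of tuples
   finite; it is implied by the condition that the lengths sum to 2 * n.
   For n < 0 that condition is unsatisfiable, so the count is 0. *)
Definition G (n : int) (m k : nat) : nat :=
  #|[set t : m.-tuple ((absz (2 * n)).-bseq bool) |
      [&& [forall i, dyck (tnth t i)],
          \sum_(i < m) (size (tnth t i))%:Z == 2 * n
        & [forall i, forall j,
             `|height (tnth t i) - height (tnth t j)| <= k%:Z]]]|.

(* Main.v *)
(* Mark path length by y, put x = y^2, and let E_h be the series of Dyck paths
   of height < h, so that E_0 = 0 and E_{h+1} (1 - x E_h) = 1.  Sorting tuples
   by their minimal height h gives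
     G_n(m,k) = [y^(2n)] sum_h (E_{h+k+1} - E_h)^m - (E_{h+k+1} - E_{h+1})^m.
   For m = 3 the combination of k = 1 and k = 0 in the theorem, times x^2,
   telescopes: with a, b, c = E_h, E_{h+1}, E_{h+2} the products ab, bc and ca
   are affine in a, b, c over Q[x, 1/x], so the cubic summand splits into
   one-variable cubics that sum to zero when evaluated at a common point.  The limit
   of the telescoper is (1 - 4x)^2 C up to terms of low degree, where
   C = 1 + x C^2 is the Catalan series, and
   T(3,n) = 16 C_n - 8 C_{n+1} + C_{n+2}. *)
Require Import Defs.
From mathcomp Require Import all_boot all_order all_algebra.
From mathcomp Require Import zify ring lra.
Import Order.TTheory GRing.Theory Num.Theory.
Local Open Scope ring_scope.

(** * Walks in a strip and Dyck paths of bounded height *)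

(* Paths from level j to level 0 whose levels, both ends included, stay in [0, h);
   the bound on the height is strict so that h = 0 gives the empty family E_0. *)
Fixpoint walk (h j : nat) (p : seq bool) : bool :=
  (j < h)%N && match p with
  | [::] => j == 0%N
  | true :: p' => walk h j.+1 p'
  | false :: p' => (0 < j)%N && walk h j.-1 p'
  end.

Lemma psum0 p : psum p 0 = 0.
Proof. by rewrite /psum take0 big_nil. Qed.

Lemma psum_cons b p k : psum (b :: p) k.+1 = step b + psum p k.
Proof. by rewrite /psum /= big_cons. Qed.

Lemma walk_psum (h j : nat) p :
  walk h j p = (j%:Z + psum p (size p) == 0) &&
    all (fun k => 0 <= j%:Z + psum p k < h%:Z) (iota 0 (size p).+1).
Proof.
elim: p j => [|b p IH] j; first by rewrite /= psum0; lia.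
have shift (i : int) : i = j%:Z + step b ->
    all (fun k => 0 <= j%:Z + psum (b :: p) k < h%:Z) (iota 1 (size p).+1)
      = all (fun k => 0 <= i + psum p k < h%:Z) (iota 0 (size p).+1).
  move=> ->; rewrite -[1%N]addn0 iotaDl all_map; apply: eq_all => k /=.
  by rewrite add1n psum_cons addrA.
rewrite -[iota 0 _]/(0%N :: iota 1 (size p).+1) [all _ (_ :: _)]/= psum0 addr0.
case: b shift => shift.
  rewrite [walk _ _ _]/= IH -(shift j.+1%:Z) /step /= ?psum_cons ?psum0 /step; last by rewrite -addn1 PoszD.
  case: (all _ _); lia.
case: j shift => [|j] shift; rewrite [walk _ _ _]/=; last first.
  rewrite IH -(shift j%:Z) /step /= ?psum_cons ?psum0 /step; last by lia.
  by case: (all _ _); lia.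
by rewrite /= !psum_cons psum0 /step; lia.
Qed.

Lemma height_ge0 p : 0 <= height p.
Proof. by rewrite /height; elim/big_rec: _ => // i x _ x0; rewrite le_max x0 orbT. Qed.

(** The default 0 of [height] is the partial sum at index 0, so the range can start at 0; for h = 0
    both sides are then false. *)
Lemma height_lt p (h : nat) :
  (height p < h%:Z) = all (fun k => psum p k < h%:Z) (iota 0 (size p).+1).
Proof.
rewrite /height -[iota 0 _]/(0%N :: iota 1 (size p)) /= psum0 /index_iota subSS subn0.
elim: (iota 1 _) => [|k s IH]; first by rewrite big_nil andbT.
by rewrite big_cons gt_max IH /=; do ![case: (_ < _)].
Qed.

Lemma walk_dyck (h : nat) p : walk h 0 p = dyck p && (height p < h%:Z).
Proof.
rewrite walk_psum height_lt /dyck add0r -andbA; congr andb.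
have -> : all (fun k => 0 <= psum p k) (iota 1 (size p))
   = all (fun k => 0 <= psum p k) (iota 0 (size p).+1) by rewrite /= psum0.
by rewrite -all_predI; apply: eq_all => k /=; rewrite add0r.
Qed.

Lemma height_le_size p : height p <= (size p)%:Z.
Proof.
have: height p < (size p).+1%:Z; last by lia.
rewrite height_lt; apply/allP => k _.
have: psum p k <= (size (take k p))%:Z.
  rewrite /psum; elim: (take k p) => [|b s IH]; first by rewrite big_nil.
  rewrite big_cons /= -addn1 PoszD addrC; apply: lerD => //; by case: b.
by rewrite size_take_min; lia.
Qed.

(** * Counting walks; truncated generating polynomials *)

Fixpoint count_walks (h j k : nat) : nat :=
  if (j < h)%N then
    match k with
    | 0 => nat_of_bool (j == 0%N)
    | k'.+1 => (count_walks h j.+1 k' + (if j is j'.+1 then count_walks h j' k' else 0))%N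
    end
  else 0%N.

Lemma big_tuple_cons {R : Type} {idx : R} {op : Monoid.com_law idx} {T : finType} k
    (F : seq T -> R) :
  \big[op/idx]_(t : k.+1.-tuple T) F t = \big[op/idx]_(b : T) \big[op/idx]_(t : k.-tuple T) F (b :: t).
Proof.
rewrite pair_big /= (reindex (fun x : T * k.-tuple T => [tuple of x.1 :: x.2])) //=.
exists (fun t => (thead t, [tuple of behead t])) => [[b t] _|t _] /=.
  by rewrite theadE; congr pair; apply: val_inj.
by rewrite -tuple_eta.
Qed.

Lemma sum_walk h j k :
  (\sum_(t : k.-tuple bool) walk h j t = count_walks h j k)%N.
Proof.
elim: k j => [|k IH] j.
  rewrite (bigD1 [tuple]) //= big1 ?addn0; first by case: ifP.
  by move=> t /eqP[]; exact: tuple0.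
rewrite (big_tuple_cons _ (fun t => walk h j t : nat)) big_bool /=.
case: (j < h)%N => /=; last by rewrite !big1.
congr addn; first exact: IH.
case: j => [|j] /=; [exact: big1 | exact: IH].
Qed.

Lemma big_bseq {R : Type} {idx : R} {op : Monoid.com_law idx} {T : finType} N
    (F : seq T -> R) :
  \big[op/idx]_(p : N.-bseq T) F p
    = \big[op/idx]_(k < N.+1) \big[op/idx]_(t : k.-tuple T) F t.
Proof.
rewrite (sig_big_dep (fun=> true) (fun k => fun=> true)
  (fun (k : 'I_N.+1) (t : k.-tuple T) => F t)) /=.
by rewrite (reindex bseq_tagged_tuple) //=; exact: onW_bij.
Qed.

(** A polynomial stand-in for a power series in y, so identities between such series hold modulo
    ['X^N]. Here ['X] is y, ['X^2] is x, and E_h is [walk_gf N h 0]. *)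
Definition walk_gf (N h j : nat) : {poly rat} := \poly_(k < N) (count_walks h j k)%:R.

Lemma walk_gfE N h :
  \sum_(p : N.-bseq bool | walk h 0 p) 'X^(size p) = walk_gf N.+1 h 0.
Proof.
rewrite big_mkcond /= (big_bseq N (fun p => if walk h 0 p then 'X^(size p) else 0)).
rewrite /walk_gf poly_def; apply: eq_bigr => k _.
rewrite -sum_walk natr_sum scaler_suml; apply: eq_bigr => t _.
by rewrite size_tuple; case: ifP; rewrite ?scale1r ?scale0r.
Qed.

(** * The continued fraction modulo a power of y *)

Lemma dvdXnP (N : nat) (p : {poly rat}) :
  reflect (forall k, (k < N)%N -> p`_k = 0) ('X^N %| p).
Proof.
apply: (iffP idP) => [/dvdpP[q ->] k kN|p0]; first by rewrite coefMXn kN.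
rewrite -(poly_take_drop N p); have -> : take_poly N p = 0.
  by apply/polyP => k; rewrite coef_take_poly coef0; case: ifP => // /p0.
by rewrite add0r dvdp_mull.
Qed.

Lemma walk_gf_rec (N h j : nat) : (j < h)%N ->
  'X^N %| walk_gf N h j - ((j == 0%N)%:R + 'X * (walk_gf N h j.+1
                           + if j is j'.+1 then walk_gf N h j' else 0)).
Proof.
move=> jh; apply/dvdXnP => k kN.
rewrite !(coefB, coefD, coefXM) coef_poly kN -polyC_natr coefC.
case: k kN => [|k] kN /=; rewrite jh; first by rewrite addr0 subrr.
rewrite add0r coef_poly (ltnW kN) natrD.
by case: j jh => [|j] jh; rewrite ?coef0 ?coef_poly ?(ltnW kN) subrr.
Qed.

Lemma walk_gf_oob (N h j : nat) : (h <= j)%N -> walk_gf N h j = 0.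
Proof.
move=> hj; apply/polyP => k; rewrite coef_poly coef0.
by case: ifP => // _; case: k => [|k] /=; rewrite ltnNge hj.
Qed.

(** First passage: a walk from level j+1 splits at its first descent to level j, and what precedes
    is a Dyck path of height < i = h - j - 1. The proof is algebraic instead, by induction on i,
    that is, from the top of the strip downwards. *)
Lemma walk_gf_step (N h : nat) :
    (forall i, (i.+1 < h)%N ->
      'X^N %| walk_gf N i.+1 0 * (1 - 'X^2 * walk_gf N i 0) - 1) ->
  forall i j, (i + j.+1)%N = h ->
    'X^N %| walk_gf N h j.+1 - 'X * walk_gf N i 0 * walk_gf N h j.
Proof.
move=> E; elim=> [|i IH] j ijh.
  by rewrite -ijh (walk_gf_oob N 0 0) // walk_gf_oob // mulr0 mul0r subrr dvdp0.
have /IH{}IH : (i + j.+2)%N = h by lia.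
have /E{}E : (i.+1 < h)%N by lia.
have /(walk_gf_rec N) : (j.+1 < h)%N by lia.
move: (walk_gf N h j) (walk_gf N h j.+1) (walk_gf N h j.+2) IH E => w0 w1 w2 /=.
move: (walk_gf N i 0) (walk_gf N i.+1 0) => a b IH E rec.
(* Modulo ['X^N], [rec] and [IH] give w1 (1 - x a) = y w0, and b inverts 1 - x a. *)
have -> : w1 - 'X * b * w0 = b * ((w1 - (0%:R + 'X * (w2 + w0))) + 'X * (w2 - 'X * a * w1))
     - w1 * (b * (1 - 'X^2 * a) - 1) by ring.
apply: dvdp_sub; last exact: dvdp_mull.
by apply: dvdp_mull; apply: dvdp_add => //; apply: dvdp_mull.
Qed.

Lemma walk_gf_continued_fraction (N h : nat) :
  'X^N %| walk_gf N h.+1 0 * (1 - 'X^2 * walk_gf N h 0) - 1.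
Proof.
elim/ltn_ind: h => h IH.
have /walk_gf_step step : forall i, (i.+1 < h.+1)%N ->
  'X^N %| walk_gf N i.+1 0 * (1 - 'X^2 * walk_gf N i 0) - 1 by exact: IH.
have {}step := step h 0%N (addn1 h).
have := walk_gf_rec N _ _ (ltn0Sn h); rewrite eqxx => rec.
move: (walk_gf N h.+1 0) (walk_gf N h.+1 1) (walk_gf N h 0) step rec => w0 w1 a step rec.
have -> : w0 * (1 - 'X^2 * a) - 1
  = (w0 - (1 + 'X * (w1 + 0))) + 'X * (w1 - 'X * a * w0) by ring.
by apply: dvdp_add => //; apply: dvdp_mull.
Qed.

(** * Ballot and Catalan numbers, and T(3,n) *)

Lemma count_walks_short (h j k : nat) : (k < j)%N -> count_walks h j k = 0%N.
Proof.
elim: k j => [|k IH] [|j] // kj; rewrite /=; case: ifP => // _.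
by rewrite !IH //; lia.
Qed.

(* Level bounds never bind when j + k < h, so this is the ballot theorem. *)
Lemma count_walks_ballot (h j k i : nat) : (k = j + 2 * i)%N -> (j + k < h)%N ->
  (count_walks h j k + (if i is i'.+1 then 'C(k, i') else 0) = 'C(k, i))%N.
Proof.
elim: k j i => [|k IH] j i kE jkh.
  have [-> ->] : j = 0%N /\ i = 0%N by lia.
  by rewrite /= (leq_ltn_trans _ jkh).
rewrite [count_walks _ _ _]/=; have -> : (j < h)%N by lia.
have up i' : i = i'.+1 ->
    (count_walks h j.+1 k + (if i' is i''.+1 then 'C(k, i'') else 0) = 'C(k, i'))%N.
  by move=> iE; apply: IH; lia.
have down j' : j = j'.+1 ->
    (count_walks h j' k + (if i is i'.+1 then 'C(k, i') else 0) = 'C(k, i))%N.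
  by move=> jE; apply: IH; lia.
case: i kE up down => [|i] kE up down.
  rewrite count_walks_short; last by lia.
  case: j kE jkh {up} down => [|j] kE jkh; first by lia.
  by move=> /(_ _ erefl); rewrite !bin0.
have := up _ erefl; rewrite binS; case: j kE jkh {up} down => [|j] kE jkh.
  (* At level 0 no down step exists; here k = 2i + 1, and the symmetry of the binomials makes up for
     the missing term. *)
  move=> _; have : 'C(k, i.+1) = 'C(k, i) by rewrite -bin_sub; [congr 'C(_, _); lia|lia].
  by case: i kE => [|i] kE; rewrite ?bin0 ?binS; lia.
move=> /(_ _ erefl); case: i kE => [|i] kE; rewrite ?bin0 ?binS; lia.
Qed.

Lemma count_walks_catalan (h n : nat) : (2 * n < h)%N ->
  (count_walks h 0 (2 * n))%:R = (2 * n)`!%:R / (n`! * n.+1`!)%:R :> rat.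
Proof.
move=> nh; have := count_walks_ballot h 0 (2 * n) n erefl nh.
case: n nh => [|n] nh.
  by rewrite muln0 addn0 bin0 => ->; rewrite !fact0 divr1.
move/(congr1 (fun n => n%:R : rat)).
have nz m : m`!%:R != 0 :> rat by rewrite pnatr_eq0 -lt0n fact_gt0.
have binE m l : (l <= m)%N -> 'C(m, l)%:R = m`!%:R / (l`!%:R * (m - l)`!%:R) :> rat.
  move=> lm; rewrite -(bin_fact lm) !natrM mulfK ?mulf_neq0 //.
rewrite natrD !binE; try lia.
have -> : (2 * n.+1 - n = n.+2)%N by lia.
have -> : (2 * n.+1 - n.+1 = n.+1)%N by lia.
move/(canRL (addrK _)) => ->; rewrite !factS !natrM.
move: (nz n); move: (n`!%:R : rat) ((2 * n.+1)`!%:R : rat) => f g f0.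
have n0 := ler0n rat n; field; rewrite f0 !lt0r_neq0 //; lra.
Qed.

Lemma superCatalan3 (h n : nat) : (2 * n.+2 < h)%N ->
  superCatalan 3 n = 16 * (count_walks h 0 (2 * n))%:R
    - 8 * (count_walks h 0 (2 * n.+1))%:R + (count_walks h 0 (2 * n.+2))%:R.
Proof.
move=> nh; rewrite !count_walks_catalan; try lia.
have nz m : m`!%:R != 0 :> rat by rewrite pnatr_eq0 -lt0n fact_gt0.
rewrite /superCatalan -[(2 * 3)`!]/720%N -[3`!]/6%N.
have -> : (2 * n.+1 = (2 * n).+2)%N by lia.
have -> : (2 * n.+2 = (2 * n).+4)%N by lia.
rewrite !addSn add0n !factS !natrM.
move: (nz n); move: (n`!%:R : rat) ((2 * n)`!%:R : rat) => f g f0.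
have n0 := ler0n rat n; field; rewrite f0 !lt0r_neq0 //; lra.
Qed.


(** * The telescoping cubic identity *)

(* tele_upper is the part of
   x^2 ((c - a)^3 - (1 - 2x) (b - a)^3) depending on c, and tele_lower the part
   depending on a, once ab, bc and ca have been reduced. *)
Definition tele_upper (x z : {poly rat}) : {poly rat} :=
  x ^+ 2 * z ^+ 3 - 3 * x * (1 - x) * z ^+ 2 + 3 * (1 - 2 * x + 2 * x ^+ 2) * z.

Definition tele_lower (x z : {poly rat}) : {poly rat} :=
  - 2 * x ^+ 3 * z ^+ 3 + 3 * x ^+ 2 * z ^+ 2 + (3 * x - 12 * x ^+ 2) * z.

(** With U = [tele_upper] and L = [tele_lower], the reduced part in b is -(U + L)(b), so U(c) - (U +
    L)(b) + L(a) is the increment of U(b) - L(a). The last term accounts for the rest of the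
    summand, x^2 ((b - a)^3 - (c - b)^3), which telescopes as it stands. *)
Definition tele (x a b : {poly rat}) : {poly rat} :=
  tele_upper x b - tele_lower x a - x ^+ 2 * (b - a) ^+ 3.

Lemma tele_step (d x a b c : {poly rat}) :
  d %| b * (1 - x * a) - 1 -> d %| c * (1 - x * b) - 1 ->
  d %| x ^+ 2 * ((c - a) ^+ 3 - (c - b) ^+ 3 + 2 * x * (b - a) ^+ 3)
       - (tele x b c - tele x a b).
Proof.
move=> ab bc.
(* x c a = (1 - x) c + x a - 1 follows by eliminating b. *)
have ac : d %| x * c * a - (1 - x) * c - x * a + 1.
  have -> : x * c * a - (1 - x) * c - x * a + 1
    = (- x ^+ 2 * a * c - (1 - x * a) * x * c) * (b * (1 - x * a) - 1)
      - (1 - x * a) * (c * (1 - x * b) - 1) by ring.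
  by apply: dvdp_sub; apply: dvdp_mull.
(* The multipliers come from reducing ca twice in x^2 (c - a)^3 and ab twice in (1 - 2x) x^2 (b -
   a)^3; (c - b)^3 cancels against [tele]. *)
have -> : x ^+ 2 * ((c - a) ^+ 3 - (c - b) ^+ 3 + 2 * x * (b - a) ^+ 3)
       - (tele x b c - tele x a b)
   = 3 * (1 + x * a - x * c - 2 * x) * (x * c * a - (1 - x) * c - x * a + 1)
     + 3 * (1 - 2 * x) * (1 + x * a - x * b) * (b * (1 - x * a) - 1).
  by rewrite /tele /tele_upper /tele_lower; ring.
by apply: dvdp_add; apply: dvdp_mull.
Qed.

(** Repeated use of x c^2 = c - 1 brings the cubic down to degree one in c. *)
Lemma tele_limit (d x c : {poly rat}) : d %| c * (1 - x * c) - 1 ->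
  d %| tele x c c - ((1 - 8 * x + 16 * x ^+ 2) * c + 2 - 2 * x).
Proof.
move=> cc; rewrite /tele /tele_upper /tele_lower.
have -> : x ^+ 2 * c ^+ 3 - 3 * x * (1 - x) * c ^+ 2 + 3 * (1 - 2 * x + 2 * x ^+ 2) * c
    - (- 2 * x ^+ 3 * c ^+ 3 + 3 * x ^+ 2 * c ^+ 2 + (3 * x - 12 * x ^+ 2) * c)
    - x ^+ 2 * (c - c) ^+ 3 - ((1 - 8 * x + 16 * x ^+ 2) * c + 2 - 2 * x)
  = (3 - (1 + 2 * x) * (x * c + 1)) * (c * (1 - x * c) - 1) by ring.
exact: dvdp_mull.
Qed.

Lemma walk_gf1 (N : nat) : (0 < N)%N -> walk_gf N 1 0 = 1.
Proof.
move=> N0; apply/polyP => k; rewrite coef_poly coef1; case: k => [|k]; first by rewrite N0.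
by case: ifP => // _; case: k => [|k] /=; rewrite ?addn0 // .
Qed.

(** Fewer than N steps from level 0 stay below level N, so a bound of N or more never binds. *)
Lemma walk_gf_stable (N h h' : nat) : (N <= h)%N -> (N <= h')%N ->
  walk_gf N h 0 = walk_gf N h' 0.
Proof.
move=> Nh Nh'; apply/polyP => k; rewrite !coef_poly; case: ifP => // kN.
suff H : forall j, (j + k < N)%N -> count_walks h j k = count_walks h' j k by rewrite H.
elim: k {kN} => [|k IH] j jk /=.
  by rewrite !(leq_trans _ Nh) ?(leq_trans _ Nh') //; lia.
have -> : (j < h)%N by lia.
have -> : (j < h')%N by lia.
by case: j jk => [|j] jk; rewrite !IH //; lia.
Qed.

(** The polynomial -1 + 7x - 9x^2 is 2 - 2x from [tele_limit] minus 3 - 9x + 9x^2, the value of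
    [tele] at (E_0, E_1) = (0, 1). *)
Lemma telescoped_series (M : nat) : (0 < M)%N ->
  'X^M %| 'X^4 * \sum_(h < M) ((walk_gf M h.+2 0 - walk_gf M h 0) ^+ 3
               - (walk_gf M h.+2 0 - walk_gf M h.+1 0) ^+ 3
               + 2 * 'X^2 * (walk_gf M h.+1 0 - walk_gf M h 0) ^+ 3)
       - ((1 - 8 * 'X^2 + 16 * 'X^4) * walk_gf M M 0 + (-1 + 7 * 'X^2 - 9 * 'X^4)).
Proof.
move=> M0; set E := fun h => walk_gf M h 0.
have cf h : 'X^M %| E h.+1 * (1 - 'X^2 * E h) - 1 := walk_gf_continued_fraction M h.
have E0 : E 0%N = 0 by exact: walk_gf_oob.
have E1 : E 1%N = 1 by exact: walk_gf1.
have EM : E M.+1 = E M by apply: walk_gf_stable.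
have : 'X^M %| \sum_(h < M) ('X^2 ^+ 2 * ((E h.+2 - E h) ^+ 3 - (E h.+2 - E h.+1) ^+ 3
          + 2 * 'X^2 * (E h.+1 - E h) ^+ 3)
          - (tele 'X^2 (E h.+1) (E h.+2) - tele 'X^2 (E h) (E h.+1))).
  by apply: (big_ind (fun p => 'X^M %| p)) => [|p q|h _]; [exact: dvdp0|exact: dvdp_add|exact: tele_step].
have tel : \sum_(h < M) (tele 'X^2 (E h.+1) (E h.+2) - tele 'X^2 (E h) (E h.+1))
    = tele 'X^2 (E M) (E M.+1) - tele 'X^2 (E 0%N) (E 1%N).
  by rewrite -(telescope_sumr (fun h => tele 'X^2 (E h) (E h.+1))) // big_mkord.
rewrite sumrB -mulr_sumr tel EM E0 E1.
(* As E_{M+1} and E_M have the same truncation, the recurrence at M becomes the Catalan equation. *)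
have := cf M; rewrite EM -/(E M) => /tele_limit.
move: (\sum_(h < M) _) (E M) (tele _ (E M) _) => S C t.
move=> limit sum.
have -> : 'X^4 * S - ((1 - 8 * 'X^2 + 16 * 'X^4) * C + (-1 + 7 * 'X^2 - 9 * 'X^4))
  = ('X^2 ^+ 2 * S - (t - tele 'X^2 0 1))
    + (t - ((1 - 8 * 'X^2 + 16 * 'X^2 ^+ 2) * C + 2 - 2 * 'X^2)).
  rewrite /tele /tele_upper /tele_lower -[4%N]/(2*2)%N exprM; ring.
exact: dvdp_add.
Qed.

(** * From tuples of paths to coefficients *)

(** The summand at h is w exactly when the minimum of x is h and its maximum is at most h + k, and 0
    otherwise; so only h = min x can contribute. *)
Lemma sum_min_indicator (V : zmodType) (m H k : nat) (x : 'I_m.+1 -> nat) (w : V) :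
    (forall i, (x i < H)%N) ->
  \sum_(h < H) ((if [forall i, (h <= x i < h + k.+1)%N] then w else 0)
                - (if [forall i, (h < x i < h + k.+1)%N] then w else 0))
    = if [forall i, [forall j, `|(x i)%:Z - (x j)%:Z| <= k%:Z]] then w else 0.
Proof.
move=> xH; pose i0 := [arg min_(i < ord0) x i]%N.
have x_min i : (x i0 <= x i)%N by rewrite /i0; case: arg_minnP => // j _; exact.
rewrite (bigD1 (Ordinal (xH i0))) //= big1 ?addr0; last first.
  move=> h /eqP hi0; rewrite (_ : [forall i, _] = [forall i, (h < x i < h + k.+1)%N]) ?subrr //.
  have {}hi0 : nat_of_ord h <> x i0 by move=> e; apply: hi0; exact: val_inj.
  apply/forallP/forallP => hx i; move: (hx i) (hx i0) (x_min i); lia.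
rewrite [X in _ - (if X then _ else _)](_ : _ = false) ?subr0; last first.
  by apply/negP => /forallP/(_ i0); lia.
congr (if _ then _ else _); apply/forallP/forallP => hx i.
  by apply/forallP => j; move: (hx i) (hx j); lia.
by move/forallP/(_ i0): (hx i) (x_min i); lia.
Qed.

Lemma interval_gf (N h h' : nat) : (h <= h')%N ->
  \sum_(p : N.-bseq bool | dyck p && (h%:Z <= height p < h'%:Z)) 'X^(size p)
    = walk_gf N.+1 h' 0 - walk_gf N.+1 h 0.
Proof.
move=> hh'; rewrite -!walk_gfE.
rewrite [X in _ = X - _](bigID (fun p : N.-bseq bool => walk h 0 p)) /=.
rewrite [X in _ = X + _ - _](eq_bigl (fun p : N.-bseq bool => walk h 0 p)); last first.
  by move=> p /=; rewrite !walk_dyck; case: dyck; lia.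
rewrite addrC addKr; apply: eq_bigl => p; rewrite !walk_dyck; case: dyck; lia.
Qed.

Lemma gf_exp (T : finType) (Q : pred T) (f : T -> nat) (m : nat) :
  (\sum_(p | Q p) 'X^(f p)) ^+ m
    = \sum_(t : m.-tuple T | [forall i, Q (tnth t i)]) 'X^(\sum_(i < m) f (tnth t i))
    :> {poly rat}.
Proof.
have -> : (\sum_(p | Q p) 'X^(f p)) ^+ m = \prod_(i < m) \sum_(p | Q p) 'X^(f p) :> {poly rat}.
  by rewrite prodr_const card_ord.
rewrite bigA_distr_big /=.
rewrite (reindex (fun t : m.-tuple T => [ffun i => tnth t i])) /=; last first.
  exists (fun f : {ffun 'I_m -> T} => [tuple f i | i < m]) => [t _|g _].
    by apply: eq_from_tnth => i; rewrite tnth_mktuple ffunE.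
  by apply/ffunP => i; rewrite ffunE tnth_mktuple.
apply: eq_big => [t|t _]; last first.
  rewrite -expr_sum; congr (_ ^+ _); apply: eq_bigr => i _.
  by rewrite ffunE.
by apply/forallP/forallP => Qt i; have := Qt i; rewrite ffunE.
Qed.

Lemma dvdp_subXX (d p q : {poly rat}) m : d %| p - q -> d %| p ^+ m - q ^+ m.
Proof. by move=> dpq; rewrite subrXX dvdp_mulr. Qed.

Lemma walk_gf_trunc (N M h : nat) : (N <= M)%N ->
  'X^N %| walk_gf M h 0 - walk_gf N h 0.
Proof.
move=> NM; apply/dvdXnP => k kN.
by rewrite coefB !coef_poly kN (leq_trans kN NM) subrr.
Qed.

(** The paths counted by [G] have length at most N = 2n, which gives an exact identity for series
    truncated at [N.+1]. Passing to truncation M leaves the coefficients up to degree N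
    unchanged. *)
Lemma G_coef (n m k M : nat) : (2 * n < M)%N ->
  (G n%:Z m.+1 k)%:R
    = (\sum_(h < M) ((walk_gf M (h + k.+1) 0 - walk_gf M h 0) ^+ m.+1
                    - (walk_gf M (h + k.+1) 0 - walk_gf M h.+1 0) ^+ m.+1))`_(2 * n).
Proof.
move=> nM; set N := (2 * n)%N; pose T := N.-bseq bool.
transitivity (\sum_(t : m.+1.-tuple T | [forall i, dyck (tnth t i)]
    && [forall i, [forall j, `|height (tnth t i) - height (tnth t j)| <= k%:Z]])
    ('X^(\sum_(i < m.+1) size (tnth t i)))`_N : rat).
  rewrite /G; have -> : 2 * n%:Z = N%:Z by rewrite /N PoszM.
  rewrite -sum1_card natr_sum big_mkcond [RHS]big_mkcond; apply: eq_bigr => t _.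
  rewrite inE coefXn -(big_morph Posz PoszD (erefl _)) eqz_nat eq_sym.
  by rewrite andbCA; case: eqP => _; case: ifP; rewrite ?andbF ?andbT //= => ->.
rewrite -coef_sum.
apply/eqP; rewrite -subr_eq0 -coefB; apply/eqP.
suff /dvdXnP : 'X^(N.+1) %| \sum_(t : m.+1.-tuple T | [forall i, dyck (tnth t i)]
    && [forall i, [forall j, `|height (tnth t i) - height (tnth t j)| <= k%:Z]])
    'X^(\sum_(i < m.+1) size (tnth t i)) - 
    (\sum_(h < M) ((walk_gf M (h + k.+1) 0 - walk_gf M h 0) ^+ m.+1
                    - (walk_gf M (h + k.+1) 0 - walk_gf M h.+1 0) ^+ m.+1)) by exact.
have -> : \sum_(t : m.+1.-tuple T | [forall i, dyck (tnth t i)]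
    && [forall i, [forall j, `|height (tnth t i) - height (tnth t j)| <= k%:Z]])
    'X^(\sum_(i < m.+1) size (tnth t i))
  = \sum_(h < M) ((walk_gf N.+1 (h + k.+1) 0 - walk_gf N.+1 h 0) ^+ m.+1
                    - (walk_gf N.+1 (h + k.+1) 0 - walk_gf N.+1 h.+1 0) ^+ m.+1).
  under [RHS]eq_bigr => h _.
    rewrite -!interval_gf; [|lia|lia].
    rewrite !gf_exp big_mkcond [X in _ - X]big_mkcond -sumrB; over.
  rewrite exchange_big big_mkcond; apply: eq_bigr => t _ /=.
  have [/forallP dt|/forallPn[i nd]] := boolP [forall i, dyck (tnth t i)]; last first.
    apply/esym/big1 => h _.
    by do 2!case: ifP => [/forallP/(_ i)|]; rewrite ?(negPf nd) // subrr.
  (* Heights are at most 2n < M, so the sum over h < M meets every possible minimal height. *)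
  have tH i : (absz (height (tnth t i)) < M)%N.
    rewrite -ltz_nat gez0_abs ?height_ge0 //; apply: le_lt_trans (height_le_size _) _.
    by rewrite ltz_nat; apply: leq_ltn_trans (size_bseq _) nM.
  rewrite -[LHS]/(if [forall i, _] then _ else _).
  have hz i : (absz (height (tnth t i)))%:Z = height (tnth t i).
    by rewrite gez0_abs ?height_ge0.
  transitivity (if [forall i, [forall j,
     `|(absz (height (tnth t i)))%:Z - (absz (height (tnth t j)))%:Z| <= k%:Z]]
     then 'X^(\sum_(i < m.+1) size (tnth t i)) else 0 : {poly rat}).
    by congr (if _ then _ else _); apply: eq_forallb => i; apply: eq_forallb => j; rewrite !hz.
  rewrite -(sum_min_indicator _ _ M) //; apply: eq_bigr => h _.
  by congr (_ - _); congr (if _ then _ else _); apply: eq_forallb => i;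
    rewrite dt -[in RHS]hz; lia.
rewrite -sumrB; apply: (big_ind (fun p => 'X^(N.+1) %| p)) => [|p q|h _]; first exact: dvdp0.
  exact: dvdp_add.
rewrite -dvdpNr opprB.
have subACA a b c e : (a - b) - (c - e) = (a - c) - (b - e) :> {poly rat} by ring.
have trunc i j : 'X^(N.+1) %| (walk_gf M i 0 - walk_gf M j 0) ^+ m.+1
   - (walk_gf N.+1 i 0 - walk_gf N.+1 j 0) ^+ m.+1.
  by apply: dvdp_subXX; rewrite subACA; apply: dvdp_sub; exact: walk_gf_trunc.
by rewrite subACA; apply: dvdp_sub; exact: trunc.
Qed.

(** * Comparison of coefficients *)

Theorem theorem1 (n : nat) (hn : (1 <= n)%N) :
  superCatalan 3 n = (G n%:Z 3 1)%:R + 2 * (G (n%:Z - 1) 3 0)%:R.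
Proof.
(* The factor x^2 moves the coefficient of y^(2n) to y^(2n+4), which must lie below the modulus. *)
pose M := (2 * n + 5)%N.
rewrite (_ : n%:Z - 1 = n.-1%:Z); last by lia.
rewrite !(G_coef _ _ _ M); try lia.
rewrite (eq_bigr (fun h : 'I_M => (walk_gf M h.+2 0 - walk_gf M h 0) ^+ 3
    - (walk_gf M h.+2 0 - walk_gf M h.+1 0) ^+ 3)); last by move=> h _; rewrite addn2.
rewrite [in X in _ + X](eq_bigr (fun h : 'I_M => (walk_gf M h.+1 0 - walk_gf M h 0) ^+ 3));
  last by move=> h _; rewrite addn1 subrr [0 ^+ _]expr0n subr0.
have /dvdXnP/(_ (2 * n + 4)%N) := telescoped_series M ltac:(lia).
rewrite big_split /= -mulr_sumr.
move: (\sum_(h < M) _) (\sum_(h < M) _) => S1 S0.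
rewrite (superCatalan3 M); last by lia.
pose C := walk_gf M M 0; rewrite -/C.
have CE i : (i < M)%N -> (count_walks M 0 i)%:R = C`_i by move=> iM; rewrite coef_poly iM.
rewrite !CE; try lia.
move=> /(_ ltac:(lia)) key.
have : ('X^4 * S0 + 'X^6 * S1 *+ 2 - C + 'X^2 * C *+ 8 - 'X^4 * C *+ 16
    + 1 - 'X^2 *+ 7 + 'X^4 *+ 9)`_(2 * n + 4) = 0.
  by apply: etrans key; congr (polyseq _)`_ _; ring.
rewrite !(coefB, coefD, coefMn, coefXnM, coefXn, coef1).
have -> : (2 * n.+1 = 2 * n + 4 - 2)%N by lia.
have -> : (2 * n.+2 = 2 * n + 4)%N by lia.
have -> : (2 * n.-1 = 2 * n + 4 - 6)%N by lia.
(* Since n >= 1, 2n + 4 >= 6: the corrections of degree at most 4 drop out, and the shift by 6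
   reaches index 2(n - 1). *)
have neqF e : (e <= 4)%N -> (2 * n + 4 == e)%N = false by lia.
have ltF e : (e <= 6)%N -> (2 * n + 4 < e)%N = false by lia.
rewrite addnK !neqF // !ltF // [false%:R]mulr0n.
move: (S0`_(2 * n)) (S1`_(2 * n + 4 - 6)) => s0 s1.
move: (C`_(2 * n)) (C`_(2 * n + 4 - 2)) (C`_(2 * n + 4)) => c0 c1 c2.
lra.
Qed.
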